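(* Let $\sigma\ge 1$ and $n\ge 1$ be integers and let $\Sigma=\{a_1,a_2,\dots,a_\sigma\}$ be an alphabet with $a_1<a_2<\cdots<a_\sigma$. Let $D(\sigma,n)$ denote the maximum, over all words of length $n$ over $\Sigma$, of the number of distinct Lyndon factors of the word. If $n=m\sigma+p$ with integers $m\ge 0$ and $0\le p<\sigma$, then $$D(\sigma,n)=\binom{n+1}{2}-(\sigma-p)\binom{m+1}{2}-p\binom{m+2}{2}+\sigma,$$ and the maximum is attained by the word $$w=a_1^{m}\cdots a_{\sigma-p}^{m}\,a_{\sigma-p+1}^{m+1}\cdots a_{\sigma}^{m+1}.$$
   Context: A word over a finite totally ordered alphabet $\Sigma$ is a finite sequence of letters of $\Sigma$; words are compared by the lexicographic order induced by the order on $\Sigma$. A word $z$ is a factor of $w$ if $w=uzv$ for some (possibly empty) words $u,v$ (so $w$ is a factor of itself). A word is primitive if it is non-empty and is not a power $x^k$, $k\ge 2$, of a shorter word $x$. Two words $u,v$ are conjugate if $u=xy$ and $v=yx$ for some words $x,y$. A Lyndon word is a non-empty primitive word that is lexicographically least in its conjugacy class (equivalently, a non-empty word that is a single letter or is strictly smaller than each of its non-empty proper suffixes). A Lyndon factor of $w$ is a factor of $w$ that is a Lyndon word; the number of distinct Lyndon factors counts each such word once regardless of how often it occurs.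
   Formalization: The formula for D(σ,n) is asserted only for m ≥ 1: for m = 0 (n < σ) it gives C(n+1,2) − n + σ, more than the number of non-empty factor occurrences (σ=2, n=1 gives 2, but D=1). That the displayed word attains the maximum is stated for all m ≥ 0. *)

(* Defs.v *)
From HB Require Import structures.
From mathcomp Require Import all_boot all_order.

Set Implicit Arguments.
Unset Strict Implicit.
Unset Printing Implicit Defensive.

Import Order.TTheory.

(* Words are sequences; "z is a factor of w" is [infix z w] (see [infixP]).
   The decidable predicates below come with their textbook characterizations
   ([primitiveP], [conjugateP], [lyndonP]). *)

Section Words.
Context {d : Order.disp_t} {T : finOrderType d}.
Implicit Types u v w x y z : seq T.

Definition lex_le u v : bool := ((u : seqlexi T) <= (v : seqlexi T))%O.

Definition word_pow x (k : nat) : seq T := flatten (nseq k x).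

(* A root x of w = x^k is a prefix [take i w] with i < size w, and k <= size w
   when w is non-empty, so the search below is exhaustive. *)
Definition primitive w : bool :=
  (w != [::]) &&
  ~~ [exists k : 'I_(size w).+1, exists i : 'I_(size w),
        (2 <= k) && (w == word_pow (take i w) k)].

Definition conjugate u v : bool :=
  [exists i : 'I_(size u).+1, v == drop i u ++ take i u].

(* Conjugate words have the same length, so quantifying over the words of
   length [size w] covers the whole conjugacy class of w. *)
Definition lyndon w : bool :=
  primitive w && [forall v : (size w).-tuple T, conjugate w v ==> lex_le w v].

(* A factor of w has length at most [size w], so the finite type
   [(size w).-bseq T] contains each factor exactly once. *)
Definition lyndon_factors w : {set (size w).-bseq T} :=
  [set z : (size w).-bseq T | infix (z : seq T) w & lyndon z].

Definition num_lyndon_factors w : nat := #|lyndon_factors w|.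

Lemma size_word_pow x k : size (word_pow x k) = k * size x.
Proof. by rewrite /word_pow size_flatten /shape map_nseq sumn_nseq mulnC. Qed.

Lemma primitiveP w :
  reflect (w <> [::] /\
           ~ exists x k, [/\ 2 <= k, size x < size w & w = word_pow x k])
          (primitive w).
Proof.
apply: (iffP andP) => [[/eqP w0 npow]|[w0 npow]]; split => //.
- move=> [x [k [k2 xw wE]]]; case/negP: npow.
  have szw : size w = k * size x by rewrite {1}wE size_word_pow.
  have x0 : 0 < size x.
    by rewrite lt0n; apply/eqP => x0; rewrite szw x0 muln0 in xw.
  have kw : k < (size w).+1 by rewrite ltnS szw leq_pmulr.
  apply/existsP; exists (Ordinal kw); apply/existsP; exists (Ordinal xw).
  rewrite /= k2 /=; suff -> : take (size x) w = x by apply/eqP.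
  by case: k k2 wE {szw kw} => // k _ ->; rewrite /word_pow /= take_size_cat.
- exact/eqP.
- apply/negP => /existsP[k /existsP[i /andP[k2 /eqP wE]]]; apply: npow.
  exists (take i w), k; split => //.
  by rewrite size_take ltn_ord.
Qed.

Lemma conjugateP u v :
  reflect (exists x y, u = x ++ y /\ v = y ++ x) (conjugate u v).
Proof.
apply: (iffP existsP) => [[i /eqP ->]|[x [y [-> ->]]]].
  by exists (take i u), (drop i u); rewrite cat_take_drop.
have xu : size x < (size (x ++ y)).+1 by rewrite ltnS size_cat leq_addr.
by exists (Ordinal xu); rewrite /= drop_size_cat // take_size_cat.
Qed.

Lemma lyndonP w :
  reflect (primitive w /\ forall v, conjugate w v -> lex_le w v) (lyndon w).
Proof.
apply: (iffP andP) => [[pw /forallP H]|[pw H]]; split => //.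
  move=> v cwv; have /eqP sv : size v == size w.
    by case/conjugateP: cwv => x [y [-> ->]]; rewrite !size_cat addnC.
  by have /implyP := H (tcast sv (in_tuple v)); rewrite val_tcast; apply.
by apply/forallP => v; apply/implyP => /H.
Qed.

End Words.

(* The alphabet a_1 < ... < a_sigma is 'I_sigma with its usual order, the letter
   a_i being the ordinal of value i - 1. *)
Definition D (sigma n : nat) : nat :=
  \max_(w : n.-tuple 'I_sigma) num_lyndon_factors w.

Definition extremal_word (sigma m p : nat) : seq 'I_sigma :=
  flatten [seq nseq (if i < sigma - p then m else m.+1) i
          | i : 'I_sigma <- enum 'I_sigma].

(* Main.v *)
Require Import Defs.
From mathcomp Require Import all_boot all_order all_algebra.
From mathcomp Require Import zify ring.

Set Implicit Arguments.
Unset Strict Implicit.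
Unset Printing Implicit Defensive.

Import Order.TTheory GRing.Theory Num.Theory.

(** Write c_a for the number of occurrences of the letter a in w, and n for the
length of w. Call a word rising when its first letter is smaller than its last.

A Lyndon word is a single letter or rising ([lyndon_rising]). So the distinct
Lyndon factors of w number at most

    #{a : c_a > 0} + #{i < j : w_i < w_j}
      <= #{a : c_a > 0} + C(n, 2) - sum_a C(c_a, 2),

because each pair of positions carrying equal letters is lost. When w is
nondecreasing both steps are equalities: every pair of positions carrying
distinct letters is then a pair w_i < w_j, a nondecreasing rising word is
Lyndon ([sorted_rising_lyndon]), and distinct pairs of positions give distinct
rising factors ([rising_factors_uniq]).

It remains to minimize sum_a f(c_a), where f(c) = C(c, 2) - [c > 0], over the
letter counts of sum n. The increments of f are -1, 1, 2, 3, ..., so f is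
convex on the natural numbers and lies above the chord line through m and m + 1
([penalty_tangent]). Summed over the alphabet, this line depends only on n,
which bounds the number of Lyndon factors of every word of length n
([num_lyndon_factors_bound]); and a nondecreasing word all of whose counts are
m or m + 1 attains the bound ([num_lyndon_factors_balanced]). The extremal word
is of this kind. The argument does not separate the case m = 0; only the closed
formula does, since it writes f(m) as C(m, 2) - 1. *)

(** * Lyndon words and rising words *)

Section LyndonWords.
Context {d : Order.disp_t} {T : finOrderType d}.
Implicit Types (a b : T) (u v w z s : seq T).

Lemma lex_le_cons a b u v :
  lex_le (a :: u) (b :: v) = (a <= b)%O && ((b <= a)%O ==> lex_le u v).
Proof. exact: lexi_cons. Qed.

(** A nondecreasing word starts with the least of its letters, and so does its
tail: it is therefore least among all its rearrangements, conjugates included. *)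
Lemma sorted_lex_le_perm u v : sorted <=%O u -> perm_eq u v -> lex_le u v.
Proof.
rewrite le_sorted_pairwise.
elim: u v => [|a u IHu] [|b v] //=; first by move=> _ /perm_size.
move=> /andP[/allP a_min su] uv; rewrite lex_le_cons.
have ab : (a <= b)%O.
  have : b \in a :: u by rewrite (perm_mem uv) mem_head.
  by rewrite inE => /predU1P[->//|/a_min].
rewrite ab /=; apply/implyP => ba; apply: IHu => //.
have/eqP aE : a == b by rewrite eq_le ab ba.
by rewrite aE perm_cons in uv.
Qed.

Definition rising w : bool := if w is a :: s then (a < last a s)%O else false.

(** In a proper power x^k the last letter of the first copy of x precedes the
first letter of the second copy; in a rising word the former is larger, so the
power is not nondecreasing. *)
Lemma sorted_rising_primitive w : sorted <=%O w -> rising w -> primitive w.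
Proof.
case: w => // a s ws rw; apply/primitiveP; split=> // -[x [k [k2 _ wE]]].
case: k k2 wE => [|[|k]] // _; case: x => [|c x] wE.
  by have := size_word_pow (@nil T) k.+2; rewrite -wE muln0.
have [ac] : a = c /\ s = x ++ word_pow (c :: x) k.+1 by case: wE.
rewrite {}ac {a} in ws rw wE *.
move=> sE.
have lx : last c s = last c x.
  have lpow j : last (last c x) (word_pow (c :: x) j) = last c x.
    by elim: j => // j IHj; rewrite /word_pow /= last_cat -/(word_pow _ _).
  by rewrite sE last_cat lpow.
move: rw; rewrite /= lx ltNge => /negP; apply.
have cs : c \in word_pow (c :: x) k.+1 by rewrite mem_head.
move: ws; rewrite sE -cat_cons le_sorted_pairwise pairwise_cat.
by case/andP => /allrelP/(_ _ _ (mem_last _ _) cs).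
Qed.

Lemma conjugate_perm u v : conjugate u v -> perm_eq u v.
Proof. by case/conjugateP => x [y [-> ->]]; rewrite perm_catC. Qed.

Lemma sorted_rising_lyndon w : sorted <=%O w -> rising w -> lyndon w.
Proof.
move=> ws rw; apply/lyndonP; split; first exact: sorted_rising_primitive.
by move=> v /conjugate_perm; apply: sorted_lex_le_perm.
Qed.

Lemma letter_lyndon a : lyndon [:: a].
Proof.
apply/lyndonP; split=> [|v /conjugate_perm]; last exact: sorted_lex_le_perm.
apply/primitiveP; split=> // -[x [k [k2 + wE]]].
by case: x wE => // /(congr1 size); rewrite size_word_pow muln0.
Qed.

(** Any letter of a word is the first letter of one of its conjugates. *)
Lemma lyndon_head_min a s b : lyndon (a :: s) -> b \in a :: s -> (a <= b)%O.
Proof.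
case/lyndonP => _ lmin; rewrite -index_mem => bs.
set i := index b (a :: s) in bs.
have/lmin : conjugate (a :: s) (drop i (a :: s) ++ take i (a :: s)).
  apply/conjugateP; exists (take i (a :: s)), (drop i (a :: s)).
  by rewrite cat_take_drop.
rewrite (drop_nth a bs) nth_index -?index_mem // cat_cons lex_le_cons.
by case/andP.
Qed.

(** The comparison forces the first letter of s to be at most a, hence equal to
a; the same comparison then holds for the tail of s. *)
Lemma lex_le_rcons_nseq a s : all (>= a)%O s ->
  lex_le (rcons s a) (a :: s) -> s = nseq (size s) a.
Proof.
elim: s => //= b s IHs /andP[ab sa]; rewrite lex_le_cons => /andP[ba].
have/eqP bE : b == a by rewrite eq_le ba.
by rewrite ab bE => /IHs <-.
Qed.

Lemma word_pow_letter a k : word_pow [:: a] k = nseq k a.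
Proof. by rewrite /word_pow; elim: k => //= k ->. Qed.

(** The first letter a is minimal, so it remains to exclude a word a s a. Its
conjugate a a s is not smaller, which compares s a with a s and makes s a power
of a; then a s a is a proper power of a. *)
Lemma lyndon_rising w : lyndon w -> 1 < size w -> rising w.
Proof.
case: w => // a s; case/lastP: s => // s b lw _; rewrite /= last_rcons.
have wmin := lyndon_head_min lw.
have : (a <= b)%O by rewrite wmin // in_cons mem_rcons mem_head orbT.
rewrite le_eqVlt => /predU1P[bE|//]; rewrite -{b}bE in lw wmin *.
case/lyndonP: lw => /primitiveP[_ nprim] lmin; case: nprim.
have sE : s = nseq (size s) a.
  apply: lex_le_rcons_nseq.
    by apply/allP => c cs; rewrite /= wmin // in_cons mem_rcons in_cons cs !orbT.
  have/lmin : conjugate (a :: rcons s a) ([:: a] ++ a :: s).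
    by apply/conjugateP; exists (a :: s), [:: a]; rewrite cats1.
  by rewrite lex_le_cons lexx.
exists [:: a], (size s).+2; split; rewrite //= ?size_rcons //.
by rewrite word_pow_letter sE size_nseq -cats1 -(nseqD _ 1) addn1.
Qed.

End LyndonWords.

(** * Counting Lyndon factors by rising factors *)

Section Counting.
Context {d : Order.disp_t} {T : finOrderType d}.
Implicit Types (a b : T) (w z s : seq T).

(** Occurrences are listed one by one, so a factor that occurs several times is
repeated: the size is the number of pairs of positions i < j with w_i < w_j. *)
Fixpoint rising_factors w : seq (seq T) :=
  if w is a :: s then
    [seq a :: take k.+1 s | k <- iota 0 (size s) & (a < nth a s k)%O]
    ++ rising_factors s
  else [::].

Lemma mem_rising_factors w z :
  (z \in rising_factors w) = infix z w && rising z.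
Proof.
elim: w => [|a s IHs]; first by case: z.
rewrite infix_consl andb_orl -IHs [rising_factors _]/= mem_cat.
congr orb => {IHs}.
apply/mapP/andP => [[k]|[]].
  rewrite mem_filter mem_iota add0n => /andP[ak /= ks] ->; split.
    by rewrite /= eqxx prefix_take.
  by rewrite /= (take_nth a) // last_rcons.
case: z => // b z; rewrite prefix_cons => /andP[/eqP -> /prefixP[t ->]].
case/lastP: z => [|z c]; first by rewrite /= ltxx.
rewrite /= last_rcons => ac; exists (size z).
  rewrite mem_filter mem_iota add0n nth_cat nth_rcons size_cat size_rcons.
  by rewrite ltnn ltnSn eqxx ac leq_addr.
by rewrite -(size_rcons z c) take_size_cat.
Qed.

Lemma size_rising_factors a s :
  size (rising_factors (a :: s)) =
  count (> a)%O s + size (rising_factors s).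
Proof.
rewrite /= size_cat size_map size_filter; congr addn.
by rewrite -[in RHS](take_size s) -(map_nth_iota0 a (leqnn _)) count_map.
Qed.

(** Rising prefixes of a :: s are told apart by their length. None of them is a
factor of s: its last letter exceeds a, so in a nondecreasing word it contains
all the occurrences of a in a :: s, one more than s has. *)
Lemma rising_factors_uniq w : sorted <=%O w -> uniq (rising_factors w).
Proof.
rewrite le_sorted_pairwise; elim: w => //= a s IHs /andP[a_min ss].
rewrite cat_uniq IHs // andbT; apply/andP; split.
  rewrite map_inj_in_uniq ?filter_uniq ?iota_uniq //.
  move=> i j; rewrite !mem_filter !mem_iota !add0n.
  move=> /andP[_ /= si] /andP[_ /= sj].
  by case=> /(congr1 size); rewrite !size_takel // => -[].
apply/hasPn => z; rewrite mem_rising_factors => /andP[/infixW zs _] /=.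
apply/mapP => -[k]; rewrite mem_filter mem_iota add0n => /andP[ak /= ks] zE.
have: count_mem a z <= count_mem a s.
  by apply: (proj2 (count_subseqP z s)); exists z.
rewrite zE /= eqxx -[in X in _ <= X](cat_take_drop k.+1 s) count_cat.
suff /count_memPn -> : a \notin drop k.+1 s by rewrite addn0 ltnn.
apply/negP => adrop; move: ss.
rewrite -[s in pairwise _ s](cat_take_drop k.+1) pairwise_cat.
case/andP => /allrelP/(_ (nth a s k) a); rewrite (take_nth a) // mem_rcons mem_head.
by move=> /(_ isT adrop); rewrite leNgt ak.
Qed.

Definition lyndon_candidates w : seq (seq T) :=
  [seq [:: a] | a <- undup w] ++ rising_factors w.

Lemma size_lyndon_candidates w :
  size (lyndon_candidates w) = size (undup w) + size (rising_factors w).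
Proof. by rewrite size_cat size_map. Qed.

Lemma mem_lyndon_factors w z :
  (z \in [seq val x | x in lyndon_factors w]) = infix z w && lyndon z.
Proof.
apply/imageP/andP => [[x]|[zw lz]]; first by rewrite inE => /andP[? ?] ->.
have sz : size z <= size w by exact: size_infix.
by exists (Bseq sz) => //; rewrite inE zw.
Qed.

Lemma num_lyndon_factors_le w :
  num_lyndon_factors w <= size (undup w) + size (rising_factors w).
Proof.
rewrite -size_lyndon_candidates /num_lyndon_factors -(size_image val).
apply: uniq_leq_size.
  by rewrite map_inj_uniq ?enum_uniq //; apply: val_inj.
move=> z; rewrite mem_lyndon_factors mem_cat mem_rising_factors => /andP[zw lz].
rewrite zw /=; case: (ltnP 1 (size z)) => [/(lyndon_rising lz) ->|].
  by rewrite orbT.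
case: z lz zw => [|a [|//]]; first by case/lyndonP=> /primitiveP[].
by move=> _; rewrite infix1s -mem_undup => aw _; rewrite map_f.
Qed.

Lemma num_lyndon_factors_sorted w : sorted <=%O w ->
  num_lyndon_factors w = size (undup w) + size (rising_factors w).
Proof.
move=> sw; apply/eqP; rewrite eqn_leq num_lyndon_factors_le.
rewrite -size_lyndon_candidates /num_lyndon_factors -(size_image val).
apply: uniq_leq_size.
  rewrite cat_uniq map_inj_uniq ?undup_uniq ?rising_factors_uniq; last first.
  - by move=> ? ? [].
  - by [].
  rewrite andbT; apply/hasPn => z; rewrite mem_rising_factors => /andP[_ rz].
  by apply/mapP => -[a _ zE]; rewrite zE /= ltxx in rz.
move=> z; rewrite mem_lyndon_factors mem_cat mem_rising_factors.
case/orP => [/mapP[a + ->]|/andP[zw rz]].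
  by rewrite mem_undup infix1s => ->; rewrite letter_lyndon.
rewrite zw sorted_rising_lyndon //.
exact: (subseq_sorted le_trans (infixW zw)).
Qed.

Lemma sum_bin2_count_cons a s :
  \sum_(b : T) 'C(count_mem b (a :: s), 2) =
  \sum_(b : T) 'C(count_mem b s, 2) + count_mem a s.
Proof.
rewrite (bigD1 a) //= [X in _ = X + _](bigD1 a) //= eqxx add1n binS bin1.
rewrite addnAC; congr (_ + _ + _); apply: eq_bigr => b /negPf ba.
by rewrite eq_sym ba.
Qed.

(** Adding a letter a in front creates as many rising factors as there are
larger letters, and as many new pairs of equal letters as there are copies of
a; these letters occupy distinct positions. *)
Lemma size_rising_factors_le w :
  size (rising_factors w) + \sum_(a : T) 'C(count_mem a w, 2) <= 'C(size w, 2).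
Proof.
elim: w => [|a s IHs]; first by rewrite big1.
rewrite size_rising_factors sum_bin2_count_cons /= binS bin1.
rewrite [X in X + _]addnC addnACA; apply: leq_add => //.
rewrite -count_predUI (_ : count (predI _ _) s = 0) ?addn0 ?count_size //.
rewrite -(count_pred0 s); apply: eq_count => b /=.
by case: eqP => [->|]; rewrite ?ltxx ?andbF.
Qed.

(** No letter is smaller than the first one here, so the larger letters and the
copies of the first letter exhaust the tail. *)
Lemma size_rising_factors_sorted w : sorted <=%O w ->
  size (rising_factors w) + \sum_(a : T) 'C(count_mem a w, 2) = 'C(size w, 2).
Proof.
rewrite le_sorted_pairwise; elim: w => [|a s IHs]; first by rewrite big1.
rewrite pairwise_cons => /andP[/allP a_min /IHs {}IHs].
rewrite size_rising_factors sum_bin2_count_cons /= binS bin1 -IHs.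
rewrite [X in X + _]addnC addnACA; congr addn.
rewrite -(count_predC (> a)%O s); congr addn.
by apply: eq_in_count => b /a_min ab /=; rewrite -leNgt eq_le ab andbT.
Qed.

Lemma size_undup_sum w : size (undup w) = \sum_(a : T) (0 < count_mem a w).
Proof.
rewrite -(card_uniqP (undup_uniq w)) -sum1_card big_mkcond /=.
apply: eq_bigr => a _; rewrite mem_undup -has_count has_pred1.
by case: (a \in w).
Qed.

Lemma size_sum_count w : size w = \sum_(a : T) count_mem a w.
Proof.
elim: w => [|a s IHs]; first by rewrite big1.
rewrite /= big_split /= -IHs (bigD1 a) //= eqxx big1 // => b /negPf.
by rewrite eq_sym => ->.
Qed.

End Counting.

(** * Convexity and balanced words *)

Local Open Scope ring_scope.

(** The cost of a letter with c occurrences: the pairs of equal letters that it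
forms, minus the single-letter Lyndon factor that it contributes. *)
Definition penalty (c : nat) : int := 'C(c, 2)%:Z - (0 < c)%N%:Z.

Definition penalty_slope (m : nat) : int := penalty m.+1 - penalty m.

(** Discrete convexity. For m > 0 the two sides differ by (c - m)(c - m - 1) / 2,
a nonnegative number because c - m is an integer, except at c = 0, where the
indicator only raises the penalty. For m = 0 the line is -c. *)
Lemma penalty_tangent (m c : nat) :
  penalty m + (c%:Z - m%:Z) * penalty_slope m <= penalty c.
Proof.
have bin2z (k : nat) : 2 * 'C(k, 2)%:Z = k%:Z * (k%:Z - 1).
  by elim: k => // k IHk; rewrite binS bin1 PoszD mulrDr IHk; lia.
rewrite /penalty_slope /penalty binS bin1 PoszD.
have cross : 0 <= (c%:Z - m%:Z) * (c%:Z - m%:Z - 1).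
  by case: (leqP c m) => cm; [apply: mulr_le0 | apply: mulr_ge0]; lia.
have := bin2z m; have := bin2z c.
move: 'C(m, 2) 'C(c, 2) => M C HC HM.
by case: m c HC HM cross => [|m] [|c] /= HC HM cross; lia.
Qed.

Section Balance.
Context {d : Order.disp_t} {T : finOrderType d}.
Implicit Types (a : T) (w s : seq T).

Lemma penalty_count_sum w :
  \sum_(a : T) penalty (count_mem a w) =
  (\sum_(a : T) 'C(count_mem a w, 2))%N%:Z - (size (undup w))%:Z.
Proof.
rewrite size_undup_sum -!natz !natr_sum -sumrB.
by apply: eq_bigr => a _; rewrite !natz.
Qed.

(** C(n, 2) minus the chord line through m and m + 1, summed over letter counts
of total n; on the alphabet T this sum depends on n only ([tangent_sum]). *)
Definition balanced_value (n m : nat) : int :=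
  'C(n, 2)%:Z
  - (#|T|%:Z * penalty m + (n%:Z - #|T|%:Z * m%:Z) * penalty_slope m).

Lemma tangent_sum m w :
  \sum_(a : T) (penalty m + ((count_mem a w)%:Z - m%:Z) * penalty_slope m) =
  #|T|%:Z * penalty m + ((size w)%:Z - #|T|%:Z * m%:Z) * penalty_slope m.
Proof.
have sum_constz (x : int) : \sum_(a : T) x = #|T|%:Z * x.
  by rewrite sumr_const -natz mulr_natl.
have -> : (size w)%:Z = \sum_(a : T) (count_mem a w)%:Z.
  rewrite size_sum_count -natz natr_sum.
  by apply: eq_bigr => a _; rewrite natz.
by rewrite big_split /= sum_constz -mulr_suml sumrB sum_constz.
Qed.

Lemma num_lyndon_factors_bound m w :
  (num_lyndon_factors w)%:Z <= balanced_value (size w) m.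
Proof.
have : \sum_(a : T) (penalty m + ((count_mem a w)%:Z - m%:Z) * penalty_slope m)
       <= \sum_(a : T) penalty (count_mem a w).
  by apply: ler_sum => a _; apply: penalty_tangent.
rewrite tangent_sum penalty_count_sum /balanced_value.
have := num_lyndon_factors_le w; have := size_rising_factors_le w; lia.
Qed.

(** The chord line meets the penalty at m and at m + 1, so nothing is lost. *)
Lemma num_lyndon_factors_balanced m w : sorted <=%O w ->
  (forall a, (m <= count_mem a w <= m.+1)%N) ->
  (num_lyndon_factors w)%:Z = balanced_value (size w) m.
Proof.
move=> sw bal; rewrite num_lyndon_factors_sorted //.
have : \sum_(a : T) (penalty m + ((count_mem a w)%:Z - m%:Z) * penalty_slope m)
       = \sum_(a : T) penalty (count_mem a w).
  apply: eq_bigr => a _.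
  have /orP[/eqP ->|/eqP ->] : (count_mem a w == m) || (count_mem a w == m.+1).
  - by move: (count_mem a w) (bal a) => c; lia.
  - by rewrite subrr mul0r addr0.
  - by rewrite /penalty_slope; lia.
rewrite tangent_sum penalty_count_sum /balanced_value.
have := size_rising_factors_sorted sw; lia.
Qed.

Lemma sorted_blocks (k : T -> nat) s :
  sorted <=%O s -> sorted <=%O (flatten [seq nseq (k a) a | a <- s]).
Proof.
rewrite !le_sorted_pairwise; elim: s => //= a s IHs /andP[/allP a_min /IHs ss].
rewrite pairwise_cat ss andbT; apply/andP; split.
  apply/allrelP => b c /nseqP[-> _] /flattenP[_ /mapP[e es ->] /nseqP[-> _]].
  exact: a_min.
elim: (k a) => //= j ->; rewrite andbT.
by apply/allP => b /nseqP[-> _].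
Qed.

End Balance.

Local Close Scope ring_scope.

(** * The extremal word *)

Lemma sorted_extremal_word sigma m p : sorted <=%O (extremal_word sigma m p).
Proof.
apply: sorted_blocks.
have : sorted leq (map val (enum 'I_sigma)) by rewrite val_enum_ord iota_sorted.
by rewrite sorted_map leEord.
Qed.

Lemma count_extremal_word sigma m p (i : 'I_sigma) :
  count_mem i (extremal_word sigma m p) =
  if i < sigma - p then m else m.+1.
Proof.
rewrite count_flatten -map_comp sumnE big_map big_enum /=.
rewrite (bigD1 i) //= count_nseq /= eqxx mul1n.
by rewrite big1 ?addn0 // => j /negPf ji; rewrite count_nseq /= ji.
Qed.

Lemma size_extremal_word sigma m p : p <= sigma ->
  size (extremal_word sigma m p) = m * sigma + p.
Proof.
move=> ps; rewrite size_sum_count.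
transitivity (\sum_(i < sigma) (m + (sigma - p <= i))).
  apply: eq_bigr => i _; rewrite count_extremal_word.
  by case: leqP => _; rewrite ?addn0 ?addn1.
rewrite big_split /= sum_nat_const card_ord mulnC; congr addn.
have sum_ge n q : \sum_(i < n) (q <= i) = n - q.
  by elim: n => [|n IHn]; rewrite ?big_ord0 // big_ord_recr /= IHn; lia.
by rewrite sum_ge subKn.
Qed.

Theorem theorem1 (sigma n m p : nat)
    (sigma_gt0 : 0 < sigma) (n_gt0 : 0 < n)
    (p_lt : p < sigma) (nE : n = m * sigma + p) :
  (0 < m ->
     ((D sigma n)%:Z =
        'C(n.+1, 2)%N%:Z - (sigma - p)%N%:Z * 'C(m.+1, 2)%N%:Z
        - p%:Z * 'C(m.+2, 2)%N%:Z + sigma%:Z)%R)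
  /\ size (extremal_word sigma m p) = n
  /\ num_lyndon_factors (extremal_word sigma m p) = D sigma n.
Proof.
have szw : size (extremal_word sigma m p) = n.
  by rewrite size_extremal_word ?nE // ltnW.
have numw : (num_lyndon_factors (extremal_word sigma m p))%:Z%R =
            balanced_value (T := 'I_sigma) n m.
  rewrite -szw.
  apply: num_lyndon_factors_balanced (sorted_extremal_word _ _ _) _ => i.
  by rewrite count_extremal_word; case: ifP => _; rewrite leqnn leqnSn.
have maxw : num_lyndon_factors (extremal_word sigma m p) = D sigma n.
  apply/eqP; rewrite eqn_leq; apply/andP; split.
    move/eqP: szw => szw.
    pose F (w : n.-tuple 'I_sigma) := num_lyndon_factors w.
    exact: (leq_bigmax (F := F) (Tuple szw)).
  apply/bigmax_leqP => w _; rewrite -lez_nat numw -{2}(size_tuple w).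
  exact: num_lyndon_factors_bound.
split=> [m_gt0|//]; rewrite -maxw numw.
rewrite /balanced_value card_ord /penalty_slope /penalty.
have [q qE] : exists q, sigma = q + p by exists (sigma - p); lia.
(* Pascal's rule leaves C(n, 2) and C(m, 2) as the only binomials, and the
   identity is polynomial once they are abstracted. *)
rewrite !binS !bin1 m_gt0; move: 'C(n, 2) 'C(m, 2) => N M.
rewrite nE qE addnK bin0 /= !PoszD !PoszM !PoszD; ring.
Qed.
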